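(* Assume that $\mu$ is a strictly increasing, (strongly) strictly concave MOC satisfying the Osgood condition $\int_0^1\frac{dx}{\mu(x)}=\infty$, and that $$\lim_{x\to0^+}\frac{x\mu'(x)}{\mu(x)}=1.$$ Then $\mu$ is Dini-continuous, i.e. $S_\mu(x):=\int_0^x\frac{\mu(s)}{s}\,ds$ is finite for all $x>0$; $S_\mu$ is strictly increasing and (strongly) strictly concave; and $S_\mu$ lies in the same germ as $\mu$, and $S_\mu'$ in the same germ as $\mu'$, at the origin, in the sense that $$\lim_{x\to0^+}\frac{S_\mu(x)}{\mu(x)}=1,\qquad \lim_{x\to0^+}\frac{S_\mu'(x)}{\mu'(x)}=1.$$ Moreover, if $x^2\mu''(x)-x\mu'(x)+\mu(x)\ge0$ for all $x>0$, then $x^2S_\mu''(x)-xS_\mu'(x)+S_\mu(x)\ge0$ for all $x>0$.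
   Context: A modulus of continuity (MOC) is a continuous function $f\colon[0,\infty)\to[0,\infty)$ with $f(0)=0$. For a twice differentiable function $f$ on an open interval: $f$ is strictly concave if $f'$ is strictly decreasing; strongly strictly concave if $f''<0$. Here these are required on $(0,\infty)$ ($\mu$ being twice differentiable there). The parenthetical ''(strongly)'' means that the statement holds both with and without that word in the hypothesis and the conclusion simultaneously. *)

(* Defs.v *)
From HB Require Import structures.
From mathcomp Require Import all_boot all_order all_algebra.
From mathcomp Require Import all_classical all_reals all_analysis.

Set Implicit Arguments.
Unset Strict Implicit.
Unset Printing Implicit Defensive.

Import Order.TTheory GRing.Theory Num.Theory.
Import numFieldNormedType.Exports.

Local Open Scope ring_scope.
Local Open Scope classical_set_scope.

(* A function on [0, +oo[ is represented by a total function R -> R; nothing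
   below depends on its values at negative arguments. *)

Definition modulus_of_continuity (R : realType) (f : R -> R) : Prop :=
  [/\ forall x : R, 0 <= x -> 0 <= f x,
      {within `[0, +oo[, continuous f} &
      f 0 = 0].

Definition strictly_increasing (R : realType) (f : R -> R) : Prop :=
  forall x y : R, 0 <= x -> x < y -> f x < f y.

Definition twice_differentiable (R : realType) (f : R -> R) : Prop :=
  forall x : R, 0 < x -> derivable f x 1 /\ derivable (derive1 f) x 1.

Definition strictly_concave (R : realType) (f : R -> R) : Prop :=
  twice_differentiable f /\
  forall x y : R, 0 < x -> x < y -> derive1 f y < derive1 f x.

Definition strongly_strictly_concave (R : realType) (f : R -> R) : Prop :=
  twice_differentiable f /\ forall x : R, 0 < x -> derive1n 2 f x < 0.

Definition maybe_strongly_strictly_concave (R : realType) (strongly : bool)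
    (f : R -> R) : Prop :=
  if strongly then strongly_strictly_concave f else strictly_concave f.

Definition Osgood (R : realType) (f : R -> R) : Prop :=
  (\int[@lebesgue_measure R]_(x in `]0%R, 1%R]) ((f x)^-1)%:E = +oo)%E.

Definition Dini_continuous (R : realType) (f : R -> R) : Prop :=
  forall x : R, 0 < x ->
  (\int[@lebesgue_measure R]_(s in `]0%R, x]) (f s / s)%:E < +oo)%E.

(* For nonnegative [f] this real-valued integral is meaningful only when
   [Dini_continuous f] holds: it collapses an infinite value to 0. *)
Definition Dini_integral (R : realType) (f : R -> R) (x : R) : R :=
  \int[@lebesgue_measure R]_(s in `]0, x]) (f s / s).

(* Main.v *)
Require Import Defs.
From HB Require Import structures.
From mathcomp Require Import all_boot all_order all_algebra.
From mathcomp Require Import all_classical all_reals all_analysis.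
From mathcomp Require Import measurable_realfun.
From mathcomp Require Import ring lra.

(** The mean value theorem on [[0, x]] gives [x mu' x < mu x], so the slope
    [q x = mu x / x] has derivative [(x mu' - mu) / x^2 < 0]. The limit
    hypothesis says [mu' / q --> 1], so near the origin [q] is at most [2 mu'],
    and more generally [q <= c mu'] on each [`]0, b]] for some [c]. As [mu] is a
    nonnegative primitive of [mu'], this bounds the integral of [q] over
    [`]0, b]] by [c * mu b] ([ge0_integral_oc_le_primitive],
    [integral_slope_le]): the Dini integral [S] is finite, and [S <= 2 mu] near
    the origin, whence [S --> 0] there.

    Now [S' = q] and [S'' = q' < 0], which gives monotonicity, and concavity in
    both the strict and the strong sense. The ratio [S' / mu'] is the inverse of
    [x mu' / mu], hence tends to [1], and L'Hopital's rule transfers this to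
    [S / mu]. The second-order inequality for [S] is that for [mu] integrated
    once from the origin ([Dini_integral_second_order_ge0]). *)

Import Order.TTheory GRing.Theory Num.Theory.
Import numFieldNormedType.Exports.

Local Open Scope ring_scope.
Local Open Scope classical_set_scope.

(** * Derivatives and improper integrals *)

Lemma derivable1_continuous (R : realType) (f : R -> R) (x : R) :
  derivable f x 1 -> {for x, continuous f}.
Proof. by move=> /derivable1_diffP/differentiable_continuous. Qed.

Lemma is_derive_derive1 (R : realType) (f : R -> R) (x d : R) :
  is_derive x 1 f d -> derive1 f x = d.
Proof. by move=> [_ <-]; rewrite derive1E. Qed.

(** An improper form of the fundamental theorem of calculus: neither [f] nor
    the derivative of [F] need be bounded near [a]. On [[c, b]] with [a < c] the
    integral of [f] is at most [F b - F c <= F b]; let [c] decrease to [a] and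
    use monotone convergence. *)
Lemma ge0_integral_oc_le_primitive (R : realType) (f F : R -> R) (a b : R) :
  a < b ->
  {in `]a, b]%R, forall x, {for x, continuous f}} ->
  {in `]a, b]%R, forall x, derivable F x 1} ->
  {in `]a, b]%R, forall x, {for x, continuous (derive1 F)}} ->
  {in `]a, b]%R, forall x, 0 <= f x <= derive1 F x} ->
  {in `]a, b]%R, forall x, 0 <= F x} ->
  (\int[@lebesgue_measure R]_(x in `]a, b]) (f x)%:E <= (F b)%:E)%E.
Proof.
move=> ab cf dF cF fF F0.
have sub c : a < c -> {subset `[c, b]%R <= `]a, b]%R}.
  move=> ac x; rewrite !in_itv/= => /andP[cx ->]; rewrite andbT.
  exact: lt_le_trans cx.
have csub c (g : R -> R) : a < c ->
    {in `]a, b]%R, forall x, {for x, continuous g}} ->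
    {within `[c, b], continuous g}.
  by move=> ac cg; apply: continuous_subspace_itv => x /(sub _ ac)/cg.
have msub c (g : R -> R) : a < c ->
    {in `]a, b]%R, forall x, {for x, continuous g}} ->
    measurable_fun `[c, b] g.
  move=> ac cg; apply: subspace_continuous_measurable_fun => //.
  exact: csub cg.
have bound c : a < c -> c < b ->
    (\int[@lebesgue_measure R]_(x in `[c, b]) (f x)%:E <= (F b)%:E)%E.
  move=> ac cb.
  have cba : c \in `]a, b]%R by rewrite in_itv/= ac ltW.
  have le_fF : (\int[@lebesgue_measure R]_(x in `[c, b]) (f x)%:E <=
      \int[@lebesgue_measure R]_(x in `[c, b]) (derive1 F x)%:E)%E.
    apply: ge0_le_integral => //=.
    - by move=> x /(sub _ ac)/fF/andP[+ _]; rewrite lee_fin.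
    - by apply/measurable_EFinP; apply: msub ac cf.
    - by apply/measurable_EFinP; apply: msub ac cF.
    - by move=> x /(sub _ ac)/fF/andP[_ +]; rewrite lee_fin.
  apply: (le_trans le_fF).
  have LRF : derivable_oo_LRcontinuous F c b.
    split => [x xcb||].
    - by apply/dF/(sub _ ac)/subset_itv_oo_cc.
    - by apply/cvg_at_right_filter/derivable1_continuous/dF.
    - apply/cvg_at_left_filter/derivable1_continuous/dF.
      by rewrite in_itv/= ab lexx.
  rewrite (continuous_FTC2 cb (csub _ _ ac cF) LRF (fun _ _ => erefl)).
  by rewrite -EFinB lee_fin lerBlDr lerDl; exact: F0.
pose A (n : nat) : set R := `[a + n.+1%:R^-1, b].
have aA n : a < a + n.+1%:R^-1 by rewrite ltrDl invr_gt0 ltr0n.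
have -> : `]a, b]%classic = \bigcup_n A n.
  apply/seteqP; split => [x|x [n _]]; rewrite /A/= !in_itv/=; last first.
    by move=> /andP[+ ->]; rewrite andbT; exact: lt_le_trans.
  move=> /andP[ax xb]; have xa0 : 0 < x - a by rewrite subr_gt0.
  have [n _ /(_ n (leqnn n)) /= nxa] := near_infty_natSinv_lt (PosNum xa0).
  by exists n => //; rewrite /A/= in_itv/= xb andbT -lerBrDl ltW.
have cvgA : (\int[@lebesgue_measure R]_(x in A n) (f x)%:E @[n --> \oo] -->
    \int[@lebesgue_measure R]_(x in \bigcup_n A n) (f x)%:E)%E.
  apply: ge0_nondecreasing_set_cvg_integral.
  - move=> n m nm; rewrite subsetEset; apply: subset_itvr.
    by rewrite bnd_simp lerD2l lef_pV2 ?posrE ?ltr0n// ler_nat.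
  - by move=> n; exact: measurable_itv.
  - by move=> n; apply/measurable_EFinP; apply: msub (aA n) cf.
  - by move=> n x /(sub _ (aA n))/fF/andP[+ _]; rewrite lee_fin.
apply: cvge_le cvgA; have ba0 : 0 < b - a by rewrite subr_gt0.
near=> n; apply: bound => //; rewrite -ltrBrDl.
by near: n; exact: (near_infty_natSinv_lt (PosNum ba0)).
Unshelve. all: by end_near. Qed.

Lemma strongly_strictly_concaveW (R : realType) (f : R -> R) :
  strongly_strictly_concave f -> strictly_concave f.
Proof.
move=> [df d2f]; split=> // x y x0 xy.
have xyP z : z \in `[x, y]%R -> 0 < z.
  by rewrite in_itv/= => /andP[+ _]; exact: lt_le_trans.
apply: (@ltr0_derive1_lt_cc _ (derive1 f) x y); rewrite ?in_itv/= ?lexx ?ltW//.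
- by move=> z /subset_itv_oo_cc/xyP/df[].
- by move=> z /subset_itv_oo_cc/xyP/d2f.
- by apply: derivable_within_continuous => z /xyP/df[].
Qed.

(** * Strictly concave moduli and their slope from the origin *)

Definition origin_slope {R : realType} (f : R -> R) (x : R) : R := f x / x.

Section modulus.
Context {R : realType} (mu : R -> R).
Hypothesis mu_moc : modulus_of_continuity mu.
Hypothesis mu_incr : strictly_increasing mu.
Hypothesis mu_concave : strictly_concave mu.

Local Notation q := (origin_slope mu).

Lemma modulus_derivable (x : R) : 0 < x -> derivable mu x 1.
Proof. by case: mu_concave => + _ => /[apply] -[]. Qed.

Lemma modulus_is_derive (x : R) : 0 < x -> is_derive x 1 mu (derive1 mu x).
Proof. by rewrite derive1E => /modulus_derivable/derivableP. Qed.

Lemma modulus_derivable2 (x : R) : 0 < x -> derivable (derive1 mu) x 1.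
Proof. by case: mu_concave => + _ => /[apply] -[]. Qed.

Lemma modulus_gt0 (x : R) : 0 < x -> 0 < mu x.
Proof. by case: mu_moc => _ _ mu0 x0; rewrite -mu0 mu_incr. Qed.

Lemma modulus_cvg0 : mu x @[x --> 0^'+] --> (0 : R).
Proof.
by case: mu_moc => _ /continuous_within_itvcyP[_ +] mu0; rewrite mu0.
Qed.

Lemma modulus_MVT (a b : R) : 0 <= a -> a < b ->
  exists2 c, a < c < b & mu b - mu a = derive1 mu c * (b - a).
Proof.
move=> a0 ab; have [|| c] := @MVT _ mu (derive1 mu) a b ab; last first.
- by rewrite in_itv/=; exists c.
- case: mu_moc => _ + _; apply: continuous_subspaceW => x/=.
  by rewrite !in_itv/= andbT => /andP[+ _]; exact: le_trans.
- move=> x; rewrite in_itv/= => /andP[ax _].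
  exact/modulus_is_derive/(le_lt_trans a0).
Qed.

(** By the mean value theorem the derivative is positive somewhere beyond [x],
    and it is larger still at [x]. *)
Lemma modulus_derive1_gt0 (x : R) : 0 < x -> 0 < derive1 mu x.
Proof.
move=> x0; have xx1 : x < x + 1 by rewrite ltrDl.
have [c /andP[xc _]] := modulus_MVT _ _ (ltW x0) xx1.
rewrite addrAC subrr add0r mulr1 => cE.
apply: (lt_trans _ (mu_concave.2 _ _ x0 xc)).
by rewrite -cE subr_gt0 mu_incr// ltW.
Qed.

(** The secant from the origin to [(x, mu x)] has slope [derive1 mu c] for some
    [c < x], and the derivative decreases. The difference of the two
    sides is the numerator of the second derivative of the Dini integral, so
    strict concavity of [mu] makes that integral strongly strictly concave. *)
Lemma modulus_tangent_lt_secant (x : R) : 0 < x -> x * derive1 mu x < mu x.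
Proof.
move=> x0; have [c /andP[c0 cx]] := modulus_MVT _ _ (lexx 0) x0.
have [_ _ ->] := mu_moc; rewrite !subr0 mulrC => ->.
by rewrite ltr_pM2l//; exact: mu_concave.2.
Qed.

Lemma modulus_slope_is_derive (x : R) : 0 < x ->
  is_derive x 1 q ((x * derive1 mu x - mu x) / x ^+ 2).
Proof.
move=> x0; have xn0 : x != 0 by rewrite gt_eqF.
have dmu := modulus_is_derive _ x0.
have D : is_derive x 1 q _ :=
  is_deriveM dmu (is_deriveV xn0 (is_derive_id x 1)).
by apply: (is_derive_eq D); rewrite /GRing.scale/=; field.
Qed.

Lemma modulus_slope_derive1_lt0 (x : R) : 0 < x ->
  (x * derive1 mu x - mu x) / x ^+ 2 < 0.
Proof.
move=> x0; rewrite pmulr_llt0 ?invr_gt0 ?exprn_gt0//.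
by rewrite subr_lt0 modulus_tangent_lt_secant.
Qed.

Lemma modulus_slope_decreasing (x y : R) : 0 < x -> x < y -> q y < q x.
Proof.
move=> x0 xy; have xyP z : z \in `[x, y]%R -> 0 < z.
  by rewrite in_itv/= => /andP[+ _]; exact: lt_le_trans.
apply: (@ltr0_derive1_lt_cc _ q x y); rewrite ?in_itv/= ?lexx ?ltW//.
- by move=> z /subset_itv_oo_cc/xyP/modulus_slope_is_derive[].
- move=> z /subset_itv_oo_cc/xyP z0.
  rewrite (is_derive_derive1 _ _ _ _ (modulus_slope_is_derive _ z0)).
  exact: modulus_slope_derive1_lt0.
- by apply: derivable_within_continuous => z /xyP/modulus_slope_is_derive[].
Qed.

Lemma modulus_slope_continuous (x : R) : 0 < x -> {for x, continuous q}.
Proof. by move=> /modulus_slope_is_derive[/derivable1_continuous]. Qed.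

(** The right-hand side is the value at [b] of a primitive of [c * derive1 mu].
    With [b] arbitrary this gives finiteness of the Dini integral; with [c = 2]
    and [b] small, its convergence to [0] at the origin. *)
Lemma integral_slope_le (b c : R) : 0 < b ->
  (forall x, 0 < x <= b -> q x <= c * derive1 mu x) ->
  (\int[@lebesgue_measure R]_(s in `]0%R, b]) (q s)%:E <= (c * mu b)%:E)%E.
Proof.
move=> b0 qc.
have c0 : 0 <= c.
  rewrite -(pmulr_lge0 _ (modulus_derive1_gt0 _ b0)).
  apply: le_trans (qc b _); last by rewrite b0 lexx.
  by rewrite divr_ge0 ?ltW ?modulus_gt0.
have cmuE x : 0 < x -> derive1 (fun y => c * mu y) x = c * derive1 mu x.
  by move=> x0; rewrite derive1Ml//; exact: modulus_derivable.
have pos x : x \in `]0, b]%R -> 0 < x by rewrite in_itv/= => /andP[].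
apply: (@ge0_integral_oc_le_primitive _ q (fun x => c * mu x)) => //.
- by move=> x /pos/modulus_slope_continuous.
- by move=> x /pos/modulus_derivable d; exact: derivableM.
- move=> x /pos x0.
  apply: derivable1_continuous.
  apply: (@near_eq_derivable _ _ _ (fun y => c * derive1 mu y)).
    by near=> y; rewrite cmuE//; near: y; exact: lt_nbhsr.
  by apply: derivableM => //; exact: modulus_derivable2.
- move=> x xb; have x0 := pos _ xb; rewrite cmuE// qc//.
  by rewrite divr_ge0 ?ltW ?modulus_gt0.
- by move=> x /pos/modulus_gt0/ltW; exact: mulr_ge0.
Unshelve. all: by end_near. Qed.

(** * Comparison of the slope with the derivative *)

Hypothesis mu_lim : x * derive1 mu x / mu x @[x --> 0^'+] --> (1 : R).

(** The constant [2] stands for any number exceeding the limit [1] of the ratio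
    of the two sides. *)
Lemma slope_le_twice_derive1_near0 :
  exists2 d : R, 0 < d & forall x, 0 < x <= d -> q x <= 2 * derive1 mu x.
Proof.
have half1 : (2^-1 : R) < 1 by lra.
have /cvgr_ge/(_ _ half1) [e /= e0 He] := mu_lim.
(* Halving passes from the open ball of radius [e] to a closed interval. *)
exists (e / 2); first by rewrite divr_gt0.
move=> x /andP[x0 xe]; have mux := modulus_gt0 _ x0.
have : 2^-1 <= x * derive1 mu x / mu x.
  by apply: He => //=; rewrite sub0r normrN gtr0_norm//; lra.
rewrite ler_pdivlMr// => h.
by rewrite ler_pdivrMr//; lra.
Qed.

(** The bound near the origin extends to all of [`]0, b]] because, past the
    radius [d] of that neighborhood, both sides are decreasing: the slope is at
    most its value at [d], and the derivative at least its value at [b]. *)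
Lemma slope_le_derive1 (b : R) : 0 < b ->
  exists c : R, forall x, 0 < x <= b -> q x <= c * derive1 mu x.
Proof.
move=> b0; have [d d0 Hd] := slope_le_twice_derive1_near0.
have dmu x := modulus_derive1_gt0 x.
exists (2 + q d / derive1 mu b) => x /andP[x0 xb].
have k0 : 0 <= q d / derive1 mu b.
  by rewrite !divr_ge0 ?ltW ?dmu ?modulus_gt0.
have := dmu _ x0; have [xd|dx] := leP x d.
  have := Hd x; rewrite x0 xd => /(_ isT); nra.
have qxd := modulus_slope_decreasing _ _ d0 dx.
have mubx : derive1 mu b <= derive1 mu x.
  by move: xb; rewrite le_eqVlt => /predU1P[->//|/(mu_concave.2 _ _ x0)/ltW].
have : q d = q d / derive1 mu b * derive1 mu b by rewrite divfK// gt_eqF// dmu.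
nra.
Qed.

Lemma modulus_Dini_continuous : Dini_continuous mu.
Proof.
move=> x x0; have [c Hc] := slope_le_derive1 _ x0.
by apply: (le_lt_trans (integral_slope_le _ _ x0 Hc)); rewrite ltry.
Qed.

Lemma slope_integrable (b : R) :
  (@lebesgue_measure R).-integrable `]0, b] (EFin \o q).
Proof.
have [b0|b0] := ltP 0 b; last first.
  by rewrite set_itv_ge ?bnd_simp -?leNgt//; exact: integrable_set0.
have mq : measurable_fun `]0, b] q.
  apply: subspace_continuous_measurable_fun => //.
  apply: continuous_subspace_itv => x; rewrite in_itv/= => /andP[x0 _].
  exact: modulus_slope_continuous.
apply/integrableP; split; first exact/measurable_EFinP.
apply: le_lt_trans (modulus_Dini_continuous _ b0).
rewrite le_eqVlt; apply/orP; left; apply/eqP/eq_integral => x.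
rewrite inE/= in_itv/= => /andP[x0 _].
by rewrite ger0_norm// divr_ge0 ?ltW ?modulus_gt0.
Qed.

(** * The Dini integral *)

Local Notation S := (Dini_integral mu).

Lemma Dini_integral_is_derive (x : R) : 0 < x -> is_derive x 1 S (q x).
Proof.
move=> x0; have xx1 : x < x + 1 by rewrite ltrDl.
have [||dS SE] := continuous_FTC1 xx1 (slope_integrable (x + 1)).
- exact: x0.
- exact: modulus_slope_continuous.
by apply: DeriveDef => //; rewrite -derive1E.
Qed.

Lemma Dini_integral_derive1 (x : R) : 0 < x -> derive1 S x = q x.
Proof. by move=> /Dini_integral_is_derive/is_derive_derive1. Qed.

Lemma Dini_integral_is_derive2 (x : R) : 0 < x ->
  is_derive x 1 (derive1 S) ((x * derive1 mu x - mu x) / x ^+ 2).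
Proof.
move=> x0; apply: (near_eq_is_derive _ (modulus_slope_is_derive _ x0)).
by near=> y; rewrite Dini_integral_derive1//; near: y; exact: lt_nbhsr.
Unshelve. all: by end_near. Qed.

Lemma Dini_integral_derive2 (x : R) : 0 < x ->
  derive1n 2 S x = (x * derive1 mu x - mu x) / x ^+ 2.
Proof. by move=> /Dini_integral_is_derive2/is_derive_derive1. Qed.

Lemma Dini_integral_ge0 (x : R) : 0 <= S x.
Proof.
apply: Rintegral_ge0 => s /=; rewrite in_itv/= => /andP[s0 _].
by rewrite divr_ge0 ?ltW ?modulus_gt0.
Qed.

Lemma Dini_integral_increasing : strictly_increasing S.
Proof.
have incr x y : 0 < x -> x < y -> S x < S y.
  move=> x0 xy; have xyP z : z \in `[x, y]%R -> 0 < z.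
    by rewrite in_itv/= => /andP[+ _]; exact: lt_le_trans.
  apply: (@gtr0_derive1_lt_cc _ S x y); rewrite ?in_itv/= ?lexx ?ltW//.
  - by move=> z /subset_itv_oo_cc/xyP/Dini_integral_is_derive[].
  - move=> z /subset_itv_oo_cc/xyP z0; rewrite Dini_integral_derive1//.
    by rewrite divr_gt0 ?modulus_gt0.
  - by apply: derivable_within_continuous => z /xyP/Dini_integral_is_derive[].
(* The derivative of [S] is only controlled on positive arguments, so the
   origin is compared with [y] through the intermediate point [y / 2]. *)
move=> x y; rewrite le_eqVlt => /predU1P[<- y0|]; last exact: incr.
have -> : S 0 = 0 by rewrite /Dini_integral set_itvoc0 Rintegral_set0.
by apply: le_lt_trans (Dini_integral_ge0 (y / 2)) _; apply: incr; lra.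
Qed.

Lemma Dini_integral_strongly_strictly_concave : strongly_strictly_concave S.
Proof.
split=> x x0.
  have [? _] := Dini_integral_is_derive _ x0.
  by have [] := Dini_integral_is_derive2 _ x0.
by rewrite Dini_integral_derive2// modulus_slope_derive1_lt0.
Qed.

Lemma Dini_integral_cvg0 : S x @[x --> 0^'+] --> (0 : R).
Proof.
have [d d0 Hd] := slope_le_twice_derive1_near0.
apply: (@squeeze_cvgr _ _ _ _ (fun=> 0) (fun x => 2 * mu x)).
- near=> x; rewrite Dini_integral_ge0/=.
  have x0 : 0 < x by near: x; exact: nbhs_right_gt.
  have xd : x <= d by near: x; exact: nbhs_right_le.
  rewrite -lee_fin /Dini_integral /Rintegral fineK; last first.
    by apply: integrable_fin_num => //; exact: slope_integrable.
  apply: integral_slope_le => // y /andP[y0 yx].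
  by apply: Hd; rewrite y0 (le_trans yx).
- exact: cvg_cst.
- by rewrite -[X in _ --> X](mulr0 2); apply: cvgM modulus_cvg0; exact: cvg_cst.
Unshelve. all: by end_near. Qed.

Lemma Dini_integral_derive1_ratio :
  derive1 S x / derive1 mu x @[x --> 0^'+] --> (1 : R).
Proof.
have : (x * derive1 mu x / mu x)^-1 @[x --> 0^'+] --> (1^-1 : R).
  by apply: cvgV mu_lim; exact: oner_neq0.
rewrite invr1; apply: cvg_trans; apply: near_eq_cvg; near=> x.
have x0 : 0 < x by near: x; exact: nbhs_right_gt.
rewrite Dini_integral_derive1// /origin_slope.
have := modulus_gt0 _ x0; have := modulus_derive1_gt0 _ x0.
by move=> /gt_eqF dmu /gt_eqF mux; field; rewrite dmu mux gt_eqF.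
Unshelve. all: by end_near. Qed.

Lemma Dini_integral_ratio : S x / mu x @[x --> 0^'+] --> (1 : R).
Proof.
have pos x : x \in `]0, (1 : R)[%R -> 0 < x by rewrite in_itv/= => /andP[].
apply: (@lhopital_at_right _ S (derive1 S) mu (derive1 mu) 0 1 1) => //.
- move=> x /pos x0; rewrite Dini_integral_derive1//.
  exact: Dini_integral_is_derive.
- by move=> x /pos/modulus_is_derive.
- exact: Dini_integral_cvg0.
- exact: modulus_cvg0.
- by move=> x /pos x0; rewrite gt_eqF// modulus_derive1_gt0.
- exact: Dini_integral_derive1_ratio.
Qed.

(** Since [x^2 S'' = x mu' - mu] and [x S' = mu], the expression equals
    [h = x mu' - 2 mu + S]. Its derivative is [(x^2 mu'' - x mu' + mu) / x >= 0]
    and it tends to [0] at the origin, so it is nonnegative. *)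
Lemma Dini_integral_second_order_ge0 :
  (forall x : R, 0 < x ->
      0 <= x ^+ 2 * derive1n 2 mu x - x * derive1 mu x + mu x) ->
  forall x : R, 0 < x ->
      0 <= x ^+ 2 * derive1n 2 S x - x * derive1 S x + S x.
Proof.
move=> mu2 b b0.
pose h x := x * derive1 mu x - 2 * mu x + S x.
have -> : b ^+ 2 * derive1n 2 S b - b * derive1 S b + S b = h b.
  rewrite Dini_integral_derive2// Dini_integral_derive1// /origin_slope /h.
  by field; rewrite gt_eqF.
have dh (x : R) : 0 < x -> is_derive x 1 h
    ((x ^+ 2 * derive1n 2 mu x - x * derive1 mu x + mu x) / x).
  move=> x0.
  have d1 := modulus_is_derive _ x0.
  have d2 : is_derive x 1 (derive1 mu) (derive1n 2 mu x).
    by rewrite /derive1n/= derive1E; exact/derivableP/modulus_derivable2.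
  have dS := Dini_integral_is_derive _ x0.
  have D : is_derive x 1 h _ :=
    is_deriveD (is_deriveB (is_deriveM (is_derive_id x 1) d2)
      (is_deriveM (is_derive_cst (2 : R) x 1) d1)) dS.
  apply: (is_derive_eq D); rewrite /GRing.scale/= /origin_slope.
  by field; rewrite gt_eqF.
have h0 : h x @[x --> 0^'+] --> (0 : R).
  have xdmu0 : x * derive1 mu x @[x --> 0^'+] --> (0 : R).
    have : x * derive1 mu x / mu x * mu x @[x --> 0^'+] --> (1 * 0 : R).
      exact: cvgM mu_lim modulus_cvg0.
    rewrite mulr0; apply: cvg_trans; apply: near_eq_cvg; near=> x.
    have /modulus_gt0/gt_eqF mux : 0 < x by near: x; exact: nbhs_right_gt.
    by rewrite divfK// mux.
  have := cvgD (cvgB xdmu0 (cvgM (cvg_cst (2 : R)) modulus_cvg0))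
    Dini_integral_cvg0.
  by rewrite mulr0 subr0 addr0; apply.
apply: (cvgr_to_le h0); near=> a.
have a0 : 0 < a by near: a; exact: nbhs_right_gt.
have ab : a <= b by near: a; exact: nbhs_right_le.
have abP z : z \in `[a, b]%R -> 0 < z.
  by rewrite in_itv/= => /andP[+ _]; exact: lt_le_trans.
apply: (@ger0_derive1_le_cc _ h a b); rewrite ?in_itv/= ?lexx ?ab//.
- by move=> z /subset_itv_oo_cc/abP/dh[].
- move=> z /subset_itv_oo_cc/abP z0.
  rewrite (is_derive_derive1 _ _ _ _ (dh _ z0)).
  by rewrite divr_ge0 ?mu2// ltW.
- by apply: derivable_within_continuous => z /abP/dh[].
Unshelve. all: by end_near. Qed.

End modulus.

(** * Germ, monotonicity and concavity of the Dini integral *)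

Theorem proposition11p1 (R : realType) (strongly : bool) (mu : R -> R)
  (mu_moc : modulus_of_continuity mu)
  (mu_incr : strictly_increasing mu)
  (mu_concave : maybe_strongly_strictly_concave strongly mu)
  (mu_Osgood : Osgood mu)
  (mu_lim : x * derive1 mu x / mu x @[x --> 0^'+] --> (1 : R)) :
  Dini_continuous mu /\
  strictly_increasing (Dini_integral mu) /\
  maybe_strongly_strictly_concave strongly (Dini_integral mu) /\
  (Dini_integral mu x / mu x @[x --> 0^'+] --> (1 : R)) /\
  (derive1 (Dini_integral mu) x / derive1 mu x @[x --> 0^'+] --> (1 : R)) /\
  ((forall x : R, 0 < x ->
      0 <= x ^+ 2 * derive1n 2 mu x - x * derive1 mu x + mu x) ->
   forall x : R, 0 < x ->
      0 <= x ^+ 2 * derive1n 2 (Dini_integral mu) x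
           - x * derive1 (Dini_integral mu) x + Dini_integral mu x).
Proof.
have concave : strictly_concave mu.
  by case: strongly mu_concave => //; exact: strongly_strictly_concaveW.
split; first exact: modulus_Dini_continuous.
split; first exact: Dini_integral_increasing.
split.
  have sS : strongly_strictly_concave (Dini_integral mu).
    exact: Dini_integral_strongly_strictly_concave.
  by case: (strongly) => //; exact: strongly_strictly_concaveW.
split; first exact: Dini_integral_ratio.
split; first exact: Dini_integral_derive1_ratio.
exact: Dini_integral_second_order_ge0.
Qed.
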